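(* Let $n\geq 0$ and let $x_1,\dots,x_n\in 2^\omega$ be distinct points of the Cantor space. Then the pointwise stabiliser $(\mathrm{Homeo}\,2^\omega)_{(x_1,\dots,x_n)}=\{g\in\mathrm{Homeo}\,2^\omega: g(x_i)=x_i\ \forall i\in[n]\}$ has ample generics.
   Context: $\mathrm{Homeo}\,2^\omega$ is the group of homeomorphisms of the Cantor space, with its standard Polish topology (the compact-open topology, equivalently the topology of pointwise convergence of its action on the clopen subsets of $2^\omega$); the stabiliser carries the subspace topology. For a topological group $G$ and $m\in\mathbb{N}$, $G$ acts on $G^m$ by diagonal conjugation $(h_1,\dots,h_m)^g=(g^{-1}h_1g,\dots,g^{-1}h_mg)$; a tuple is generic if its orbit is comeagre in $G^m$; $G$ has ample generics if it has generic $m$-tuples for all $m\in\mathbb{N}$. $[n]=\{1,\dots,n\}$. *)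

(* Defs.v *)
From HB Require Import structures.
From mathcomp Require Import all_boot all_order all_algebra.
From mathcomp Require Import all_classical all_reals topology cantor.
Set Implicit Arguments. Unset Strict Implicit. Unset Printing Implicit Defensive.
Local Open Scope classical_set_scope.

Definition Cantor := cantor_space.

Record homeo := Homeo {
  hfun : Cantor -> Cantor;
  hinv : Cantor -> Cantor;
  hfun_cont : continuous hfun;
  hinv_cont : continuous hinv;
  hfunK : cancel hfun hinv;
  hinvK : cancel hinv hfun }.

Definition stab (n : nat) (x : 'I_n -> Cantor) : set homeo :=
  [set g | forall i, hfun g (x i) = x i].

Definition tuples (n : nat) (x : 'I_n -> Cantor) (m : nat) : set ('I_m -> homeo) :=
  [set t | forall j, stab x (t j)].

(* Basic open neighbourhood of a tuple t in G^m for the product of the topology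
   of pointwise convergence of the action on clopen subsets (restricted to the
   stabiliser): all tuples s in G^m with s_j(C) = t_j(C) for each clopen cs_i. *)
Definition basic_nbhd n (x : 'I_n -> Cantor) m (t : 'I_m -> homeo)
    k (cs : 'I_k -> set Cantor) : set ('I_m -> homeo) :=
  [set s | @tuples n x m s /\
     forall j i, hfun (s j) @` cs i = hfun (t j) @` cs i].

Definition gopen n (x : 'I_n -> Cantor) m (U : set ('I_m -> homeo)) : Prop :=
  U `<=` @tuples n x m /\
  forall t, U t -> exists (k : nat) (cs : 'I_k -> set Cantor),
    (forall i, clopen (cs i)) /\ basic_nbhd x t cs `<=` U.

Definition gnowhere_dense n (x : 'I_n -> Cantor) m (A : set ('I_m -> homeo)) : Prop :=
  forall U, gopen x U -> U !=set0 ->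
    exists V, [/\ gopen x V, V !=set0, V `<=` U & V `&` A = set0].

Definition gmeagre n (x : 'I_n -> Cantor) m (A : set ('I_m -> homeo)) : Prop :=
  exists N : nat -> set ('I_m -> homeo),
    (forall k, gnowhere_dense x (N k)) /\ A `<=` \bigcup_k N k.

Definition gcomeagre n (x : 'I_n -> Cantor) m (A : set ('I_m -> homeo)) : Prop :=
  gmeagre x (@tuples n x m `\` A).

Definition conj_orbit n (x : 'I_n -> Cantor) m (t : 'I_m -> homeo)
    : set ('I_m -> homeo) :=
  [set s | exists g, stab x g /\
     forall j (y : Cantor), hfun (s j) y = hinv g (hfun (t j) (hfun g y))].

Definition generic_tuple n (x : 'I_n -> Cantor) m (t : 'I_m -> homeo) : Prop :=
  @tuples n x m t /\ gcomeagre x (conj_orbit x t).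

Definition ample_generics n (x : 'I_n -> Cantor) : Prop :=
  forall m : nat, exists t : 'I_m -> homeo, generic_tuple x t.

(* Main.v *)
(** A homeomorphism tuple seen through a finite clopen partition is a finite
    graph with [m] surjective relations, in which the points [x i] give marked
    vertices with loops; finer partitions give maps that are surjective on
    vertices and on edges. Every such graph is covered by an unfolding: its
    vertices are origins, vertices remembering the direction of the free group
    that leads back to an origin and having a single neighbor in every other
    direction, and isolated loops around the [x i]. Since everything is
    determined when moving away from an origin, unfoldings are amalgamation
    bases. Hence comeagrely many tuples have arbitrarily fine partitions that are
    amalgamation bases and realize every extension of these; such tuples exist by
    a Baire category argument, and any two of them are conjugate by
    back-and-forth. *)
From HB Require Import structures.
Require Import Defs.
From mathcomp Require Import all_boot.
From mathcomp Require Import all_classical topology cantor.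
Set Implicit Arguments.
Unset Strict Implicit.
Unset Printing Implicit Defensive.
Local Open Scope classical_set_scope.

(** * Locally constant functions on the Cantor space *)

Definition agree k (x y : Cantor) := forall i, i < k -> x i = y i.

Lemma agree_sym k x y : agree k x y -> agree k y x.
Proof. by move=> xy i ik; rewrite xy. Qed.

Lemma agree_trans k x y z : agree k x y -> agree k y z -> agree k x z.
Proof. by move=> xy yz i ik; rewrite xy // yz. Qed.

Lemma agree_leq k l x y : k <= l -> agree l x y -> agree k x y.
Proof. by move=> kl xy i ik; apply/xy/(leq_trans ik). Qed.

Lemma agree_eq (x y : Cantor) : (forall k, agree k x y) -> x = y.
Proof. by move=> xy; apply/funext => i; apply: (xy i.+1). Qed.

Lemma agree_nbhs k (x : Cantor) : nbhs x (agree k x).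
Proof.
elim: k => [|k IH]; first by apply: filterS filterT => y _ i.
have nbhs_coord : nbhs x [set y : Cantor | y k = x k].
  have := @proj_continuous nat (fun=> bool) k x [set b | b = x k].
  by apply; rewrite nbhs_principalE; move=> b /= ->.
apply: filterS2 IH nbhs_coord => y /= xy yk i.
by rewrite ltnS leq_eqVlt => /orP[/eqP->//|]; exact: xy.
Qed.

Lemma nbhs_agreeP (x : Cantor) (U : set Cantor) :
  nbhs x U <-> exists k, agree k x `<=` U.
Proof.
split=> [|[k kU]]; last exact: filterS kU (agree_nbhs k x).
pose F := filter_from [set: nat] (fun k => agree k x).
have filterF : Filter F.
  apply: filter_from_filter; first by exists 0.
  move=> i j _ _; exists (maxn i j) => // y xy.
  by split; apply: agree_leq xy; rewrite ?leq_maxl ?leq_maxr.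
have cvgF : F --> x.
  apply/cvg_sup => i A /= [_ [[B _ <-] Bx sBA]].
  exists i.+1 => // y xy; apply: sBA => /=.
  by move: Bx; rewrite /= /proj (xy i).
by move=> /cvgF[k _ kU]; exists k.
Qed.

Lemma agree_continuous (f : Cantor -> Cantor) :
  (forall l, exists k, forall z y, agree k z y -> agree l (f z) (f y)) ->
  continuous f.
Proof.
move=> f_agree z U /= /nbhs_agreeP[l lU]; have [k kl] := f_agree l.
by apply: filterS (agree_nbhs k z) => y /kl /lU.
Qed.

Definition locally_constant T (u : Cantor -> T) :=
  exists k, forall x y, agree k x y -> u x = u y.

Lemma locally_constant_comp T T' (u : Cantor -> T) (f : T -> T') :
  locally_constant u -> locally_constant (f \o u).
Proof. by case=> k uk; exists k => z y /uk /= ->. Qed.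

Lemma locally_constant_pair T T' (u : Cantor -> T) (v : Cantor -> T') :
  locally_constant u -> locally_constant v ->
  locally_constant (fun z => (u z, v z)).
Proof.
move=> [k uk] [l vl]; exists (maxn k l) => z y zy.
by congr pair; [apply: uk|apply: vl]; apply: agree_leq zy;
  rewrite ?leq_maxl ?leq_maxr.
Qed.

Lemma locally_constant_ffun (I : finType) T (u : I -> Cantor -> T) :
  (forall i, locally_constant (u i)) ->
  locally_constant (fun z => [ffun i => u i z]).
Proof.
move=> /choice[k uk]; exists (\max_i k i) => z y zy; apply/ffunP => i.
by rewrite !ffunE; apply: uk; apply: agree_leq zy; exact: leq_bigmax.
Qed.

Lemma clopen_locally_constantP (C : set Cantor) :
  clopen C <-> locally_constant C.
Proof.
have open_locally_constant (D : set Cantor) : locally_constant D -> open D.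
  move=> [k Dk]; rewrite openE => z Dz.
  by apply: filterS (agree_nbhs k z) => y /Dk <-.
split=> [[oC cC]|lC]; last first.
  split; first exact: open_locally_constant.
  rewrite -openC; apply: open_locally_constant.
  exact: (@locally_constant_comp _ _ C not).
have /compact_near_coveringP/(_ _ \oo
  (fun k z => forall y, agree k z y -> C z <-> C y)) := cantor_space_compact.
case=> [z _|k _ /(_ k (leqnn k)) kC]; last first.
  by exists k => z y /kC zy; apply/propext/zy.
have [k kC] : exists k, forall y, agree k z y -> C z <-> C y.
  have [Cz|nCz] := pselect (C z).
    have /nbhs_agreeP[k kC] : nbhs z C by apply: open_nbhs_nbhs.
    by exists k => y /kC.
  have /nbhs_agreeP[k kC] : nbhs z (~` C).
    by apply: open_nbhs_nbhs; split=> //; rewrite openC.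
  by exists k => y /kC.
exists (agree k z, [set l | k <= l]).
  by split; [exact: agree_nbhs|exists k].
move=> [z' l] /= [zz' kl] y z'y; rewrite -(kC _ zz').
by apply: kC; apply: agree_trans zz' _; apply: agree_leq z'y.
Qed.

Definition truncate l (z : Cantor) : {ffun 'I_l -> bool} :=
  [ffun i => z (val i)].

Lemma truncate_eqP l z y : truncate l z = truncate l y <-> agree l z y.
Proof.
split=> [/ffunP zy i il|zy]; first by have := zy (Ordinal il); rewrite !ffunE.
by apply/ffunP => i; rewrite !ffunE; exact: (zy _ (ltn_ord i)).
Qed.

Lemma locally_constant_truncate l : locally_constant (truncate l).
Proof. by exists l => z y /truncate_eqP. Qed.

Lemma locally_constant_factor T (u : Cantor -> T) :
  locally_constant u ->
  exists l (f : {ffun 'I_l -> bool} -> T), u = f \o truncate l.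
Proof.
move=> [l ul].
pose pad (w : {ffun 'I_l -> bool}) : Cantor :=
  fun i => if insub i is Some j then w j else false.
exists l, (u \o pad); apply/funext => z; apply: ul => i il.
by rewrite /pad insubT ffunE.
Qed.

Lemma locally_constant_comp_continuous T (f : Cantor -> Cantor)
    (u : Cantor -> T) :
  continuous f -> locally_constant u -> locally_constant (u \o f).
Proof.
move=> f_cont [l ul].
have [k fk] : locally_constant (fun z => truncate l (f z)).
  apply: locally_constant_ffun => i.
  have /preimage_clopen/(_ f_cont) : clopen [set z : Cantor | z (val i)].
    apply/clopen_locally_constantP; exists i.+1 => z y zy.
    by rewrite /mkset (zy i).
  move=> /clopen_locally_constantP[k fk]; exists k => z y /fk.
  by rewrite /preimage /mkset => /is_true_inj.
by exists k => z y /fk /truncate_eqP /ul.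
Qed.

(** * Colorings and homeomorphisms as limits of relations between colors *)

Definition surjective T U (u : T -> U) := forall a, exists z, u z = a.

Definition coloring T (u : Cantor -> T) := locally_constant u /\ surjective u.

Definition resolves T l (u : Cantor -> T) :=
  forall z y, u z = u y -> agree l z y.

Lemma locally_constant_image (T : finType) (u : Cantor -> T) :
  locally_constant u ->
  exists (E : finType) (q : Cantor -> E) (f : E -> T),
    coloring q /\ f \o q =1 u.
Proof.
move=> [k uk].
have uP z : `[< exists z', u z' = u z >] by apply/asboolP; exists z.
exists {a : T | `[< exists z, u z = a >]}, (fun z => exist _ (u z) (uP z)), val.
split=> //; split; first by exists k => z y /uk e; apply: val_inj.
by case=> a aP; have /asboolP[z e] := aP; exists z; apply: val_inj.
Qed.

Lemma limit_function (E F : nat -> Type) (u : forall k, Cantor -> E k)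
    (v : forall k, Cantor -> F k) (e : forall k, E k -> F k -> Prop) :
  (forall k, locally_constant (u k)) -> (forall k, coloring (v k)) ->
  (forall k z y, e k.+1 (u k.+1 z) (v k.+1 y) -> e k (u k z) (v k y)) ->
  (forall k a, exists b, e k a b) ->
  (forall k a y y', e k a (v k y) -> e k a (v k y') -> agree k y y') ->
  exists f : Cantor -> Cantor, continuous f /\
    forall z y, f z = y <-> forall k, e k (u k z) (v k y).
Proof.
move=> lu cv e_dec e_tot e_small.
pose R k z y := e k (u k z) (v k y).
have R_leq k l z y : k <= l -> R l z y -> R k z y.
  by move=> /subnK <-; elim: (l - k) => //= d IH /e_dec.
have R_tot k z : exists y, R k z y.
  have [_ sv] := cv k; have [b eb] := e_tot k (u k z); have [y yb] := sv b.
  by exists y; rewrite /R yb.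
have {}R_tot k z := cid (R_tot k z).
pose f z : Cantor := fun i => sval (R_tot i.+1 z) i.
have R_agree l z y : R l z y -> agree l y (f z).
  move=> Ry i il; have := svalP (R_tot i.+1 z); rewrite /f.
  by move/(e_small _ _ _ _ (R_leq _ _ _ _ il Ry)); exact.
have R_f k z : R k z (f z).
  have [[l vl] _] := cv k; have [y Ry] := R_tot (maxn k l) z.
  rewrite /R -(vl y); first by apply: R_leq Ry; exact: leq_maxl.
  by apply: R_agree; apply: R_leq Ry; exact: leq_maxr.
exists f; split.
- apply: agree_continuous => l; have [k uk] := lu l; exists k => z y /uk uzy.
  by apply: (e_small l (u l z)); [|rewrite uzy]; exact: R_f.
- move=> z y; split=> [<- k|Ry]; first exact: R_f.
  by apply: agree_eq => l; apply: (e_small l (u l z)) (Ry l); exact: R_f.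
Qed.

Lemma limit_homeo (E F : nat -> Type) (u : forall k, Cantor -> E k)
    (v : forall k, Cantor -> F k) (e : forall k, E k -> F k -> Prop) :
  (forall k, coloring (u k)) -> (forall k, coloring (v k)) ->
  (forall k z y, e k.+1 (u k.+1 z) (v k.+1 y) -> e k (u k z) (v k y)) ->
  (forall k a, exists b, e k a b) -> (forall k b, exists a, e k a b) ->
  (forall k a y y', e k a (v k y) -> e k a (v k y') -> agree k y y') ->
  (forall k b z z', e k (u k z) b -> e k (u k z') b -> agree k z z') ->
  exists h : homeo, forall z y, hfun h z = y <-> forall k, e k (u k z) (v k y).
Proof.
move=> cu cv e_dec e_totr e_totl e_smallr e_smalll.
have [f [f_cont fP]] :=
  limit_function (fun k => (cu k).1) cv e_dec e_totr e_smallr.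
have [g [g_cont gP]] := @limit_function _ _ v u (fun k b a => e k a b)
  (fun k => (cv k).1) cu (fun k y z => @e_dec k z y) e_totl e_smalll.
have fK : cancel f g by move=> z; apply/gP/fP.
have gK : cancel g f by move=> y; apply/fP/gP.
by exists (Homeo f_cont g_cont fK gK).
Qed.

Lemma indexed_dependent_choice (T : Type) (R : nat -> T -> T -> Prop) (a : T) :
  (forall k b, exists c, R k b c) ->
  exists S : nat -> T, S 0 = a /\ forall k, R k (S k) (S k.+1).
Proof.
move=> R_tot; pose S := fix S k :=
  if k is j.+1 then sval (cid (R_tot j (S j))) else a.
by exists S; split=> // k; exact: (svalP (cid (R_tot k (S k)))).
Qed.

(** * Interpolation of colorings *)

Lemma agree_separates (I : finType) (pt : I -> Cantor) :
  injective pt -> exists l, forall s s', agree l (pt s) (pt s') -> s = s'.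
Proof.
move=> pt_inj.
have /choice[l lP] (ss : I * I) :
    exists l, agree l (pt ss.1) (pt ss.2) -> ss.1 = ss.2.
  have [?|ne] := pselect (ss.1 = ss.2); first by exists 0.
  apply: contrapT => /forallNP never; apply/ne/pt_inj/agree_eq => k.
  by have /not_implyP[] := never k.
exists (\max_ss l ss) => s s' ss'; apply: (lP (s, s')).
by apply: agree_leq ss'; exact: leq_bigmax.
Qed.

(* The points [y] carry a single 1 beyond coordinate [k], at pairwise different
   positions, hence are distinct; late enough positions also avoid the [x i]. *)
Lemma fresh_points (I C : finType) (x : I -> Cantor) k (z : C -> Cantor) :
  exists y : C -> Cantor,
    [/\ forall c, agree k (z c) (y c), injective y & forall i c, x i <> y c].
Proof.
pose spike (w : Cantor) j : Cantor :=
  fun i => if i < k then w i else i == k + j.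
have spike_inj w w' j j' : spike w j = spike w' j' -> j = j'.
  move=> /(congr1 (fun f : Cantor => f (k + j))).
  by rewrite /spike ltnNge leq_addr /= eqxx eqn_add2l => /esym/eqP.
have /choice[b bP] i : exists b, forall j w, b < j -> x i <> spike w j.
  have [[j [w e]]|/forallNP never] := pselect (exists j w, x i = spike w j).
    exists j => j' w' jj' e'.
    by move: jj'; rewrite (@spike_inj w w' j j') ?ltnn // -e.
  by exists 0 => j w _ e; apply: (never j); exists w.
pose N := (\max_i b i).+1.
exists (fun c => spike (z c) (N + enum_rank c)); split.
- by move=> c i ik; rewrite /spike ik.
- by move=> c c' /spike_inj /addnI /val_inj /enum_rank_inj.
- move=> i c; apply: bP; rewrite addSn ltnS.
  by apply: leq_trans (leq_addr _ _); exact: leq_bigmax.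
Qed.

Lemma locally_constant_lift (S : finType) A C (q : Cantor -> A) (phi : C -> A)
    (pt : S -> Cantor) (c : S -> C) :
  locally_constant q -> surjective phi -> injective pt -> phi \o c =1 q \o pt ->
  exists q', [/\ locally_constant q', phi \o q' =1 q & q' \o pt =1 c].
Proof.
move=> [k qk] /choice[sec secK] pt_inj cP.
have [l lP] := agree_separates pt_inj.
pose M := maxn k l.
have agree_k z y : agree M z y -> q z = q y.
  by move=> zy; apply/qk/(agree_leq _ zy)/leq_maxl.
pose q' z :=
  if [pick s | `[< agree M (pt s) z >]] is Some s then c s else sec (q z).
exists q'; split.
- exists M => a b ab; rewrite /q' (agree_k a b) //.
  congr (if _ is Some _ then _ else _); apply: eq_pick => s.
  apply/asbool_equiv_eq; split=> sa; apply: agree_trans sa _ => //.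
  exact: agree_sym.
- move=> z /=; rewrite /q'; case: pickP => [s /asboolP sz|_]; last exact: secK.
  by rewrite -(agree_k _ _ sz); exact: cP.
- move=> s; rewrite /= /q'.
  case: pickP => [s' /asboolP ss'|/(_ s) /asboolP[]//].
  by congr c; apply: lP; apply: agree_leq ss'; exact: leq_maxr.
Qed.

Lemma coloring_lift (I C : finType) A (x : I -> Cantor) (q : Cantor -> A)
    (phi : C -> A) (p : I -> C) :
  injective x -> coloring q -> surjective phi -> phi \o p =1 q \o x ->
  exists q', [/\ coloring q', phi \o q' =1 q & q' \o x =1 p].
Proof.
move=> x_inj [lq sq] sphi px.
have /choice[z zP] c := sq (phi c).
have [k qk] := lq; have [y [zy y_inj xy]] := fresh_points x k z.
pose pt s := match s with inl i => x i | inr c => y c end.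
pose color s := match s with inl i => p i | inr c => c end.
have pt_inj : injective pt.
  by move=> [i|c] [i'|c'] /= => [/x_inj->//|/xy//|/esym/xy//|/y_inj->].
have [|q' [lq' phi_q' q'pt]] :=
    locally_constant_lift (c := color) lq sphi pt_inj.
  by move=> [i|c] /=; [exact: px|rewrite -(qk _ _ (zy c)) zP].
exists q'; split=> //; last by move=> i; exact: (q'pt (inl i)).
by split=> // c; exists (y c); exact: (q'pt (inr c)).
Qed.

(** * Back-and-forth *)

Definition coloring_relation :=
  forall E : finType, (Cantor -> E) -> (Cantor -> E) -> Prop.

Definition converse (P : coloring_relation) : coloring_relation :=
  fun E u v => P E v u.

Definition forth (P : coloring_relation) :=
  forall (E : finType) (u v : Cantor -> E) l, P E u v ->
  exists (E' : finType) (u' v' : Cantor -> E') (f : E' -> E),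
    [/\ P E' u' v', f \o u' =1 u, f \o v' =1 v & resolves l u'].

Section BackAndForth.
Variables (n : nat) (x : 'I_n -> Cantor) (P : coloring_relation).
Hypothesis P_coloring : forall (E : finType) (u v : Cantor -> E),
  P u v -> [/\ coloring u, coloring v & u \o x =1 v \o x].
Hypothesis P_forth : forth P.
Hypothesis P_back : forth (converse P).

Record coloring_pair := ColoringPair {
  palette : finType;
  left_coloring : Cantor -> palette;
  right_coloring : Cantor -> palette;
  pair_related : P left_coloring right_coloring }.

Definition pair_refines l (s s' : coloring_pair) :=
  [/\ exists2 f : palette s' -> palette s,
        f \o left_coloring s' =1 left_coloring s &
        f \o right_coloring s' =1 right_coloring s,
      resolves l (left_coloring s') & resolves l (right_coloring s')].

Lemma exists_pair_refines l (s : coloring_pair) :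
  exists s', pair_refines l s s'.
Proof.
have [E [u [v [f [Puv fu fv ru]]]]] := P_forth l (pair_related s).
have [E' [v' [u' [f' [Puv' fv' fu' rv']]]]] := P_back l Puv.
exists (ColoringPair Puv'); split=> //=.
  by exists (f \o f') => z /=; rewrite -?fu -?fv /= -?fu' -?fv'.
by move=> z y uzy; apply: ru; rewrite -!fu' /= uzy.
Qed.

Lemma back_and_forth (E : finType) (u v : Cantor -> E) : P u v ->
  exists g, [/\ stab x g, v \o hfun g =1 u &
    forall l, exists (E' : finType) (u' v' : Cantor -> E'),
      [/\ P u' v', v' \o hfun g =1 u' & resolves l v']].
Proof.
move=> Puv.
have [S [S0 S_refines]] := indexed_dependent_choice (ColoringPair Puv)
  (fun k => exists_pair_refines k.+1).
have SP k := P_coloring (pair_related (S k)).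
have resolved k :
    resolves k (left_coloring (S k)) /\ resolves k (right_coloring (S k)).
  by case: k => [//|k]; have [] := S_refines k.
have [|||||||g gP] := @limit_homeo _ _ (fun k => left_coloring (S k))
    (fun k => right_coloring (S k)) (fun k => eq).
- by move=> k; have [] := SP k.
- by move=> k; have [] := SP k.
- move=> k z y; have [[f fu fv] _ _] := S_refines k.
  by rewrite -fu -fv /= => ->.
- by move=> k a; exists a.
- by move=> k a; exists a.
- by move=> k a y y' -> /(resolved k).2.
- by move=> k a y y' <- /esym /(resolved k).1.
have gE k z : right_coloring (S k) (hfun g z) = left_coloring (S k) z.
  by have /(_ erefl k) := (gP z (hfun g z)).1.
exists g; split.
- by move=> i; apply/gP => k; have [_ _] := SP k; exact.
- by move=> z; have := gE 0 z; rewrite S0.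
- move=> l.
  exists (palette (S l)), (left_coloring (S l)), (right_coloring (S l)).
  by split; [exact: pair_related|exact: gE|exact: (resolved l).2].
Qed.

End BackAndForth.

Lemma stab_homogeneous n (x : 'I_n -> Cantor) (E : finType)
    (u v : Cantor -> E) :
  injective x -> coloring u -> coloring v -> u \o x =1 v \o x ->
  exists2 g, stab x g & v \o hfun g =1 u.
Proof.
move=> x_inj cu cv uvx.
pose P : coloring_relation := fun E u v =>
  [/\ coloring u, coloring v & u \o x =1 v \o x].
have forthP : forth P.
  move=> F a b l [[la sa] cb abx].
  have [F' [a' [f [ca' fa']]]] :=
    locally_constant_image
      (locally_constant_pair la (locally_constant_truncate l)).
  have fa z : (f (a' z)).1 = a z by have := fa' z => /= ->.
  have [||b' [cb' fb b'x]] :=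
      @coloring_lift _ _ _ x b (fst \o f) (a' \o x) x_inj cb.
  - by move=> c; have [z <-] := sa c; exists (a' z); exact: fa.
  - by move=> i; rewrite -abx; exact: fa.
  exists F', a', b', (fst \o f); split=> //; first by split=> // i; rewrite b'x.
  move=> z y azy; apply/truncate_eqP.
  by have := fa' z; have := fa' y; rewrite /= azy => -> [].
have [||||g [gx gu _]] := @back_and_forth _ x P _ _ _ E u v; last by exists g.
- by [].
- exact: forthP.
- move=> F a b l [ca cb abx].
  have [|F' [a' [b' [f [[? ? a'b'x] ? ? ?]]]]] := forthP F a b l.
    by split=> // i; rewrite abx.
  by exists F', a', b', f; split=> //; split=> // i; rewrite a'b'x.
- by split.
Qed.

Lemma stab_realizes_rel n (x : 'I_n -> Cantor) (C : finType) (e : rel C)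
    (q : Cantor -> C) :
  injective x -> coloring q ->
  (forall c, exists c', e c c') -> (forall c', exists c, e c c') ->
  (forall i, e (q (x i)) (q (x i))) ->
  exists2 g, stab x g &
    forall c c', e c c' <-> exists2 z, q z = c & q (hfun g z) = c'.
Proof.
move=> x_inj cq e_totr e_totl ex.
pose Ee : finType := {p : C * C | e p.1 p.2}.
pose mark_edge i : Ee := exist _ (q (x i), q (x i)) (ex i).
have [|//|u [cu eu ux]] :=
    @coloring_lift _ Ee _ x q (fun p => (val p).1) mark_edge x_inj cq.
  by move=> c; have [c' ecc'] := e_totr c; exists (exist _ (c, c') ecc').
have [|//|v [cv ev vx]] :=
    @coloring_lift _ Ee _ x q (fun p => (val p).2) mark_edge x_inj cq.
  by move=> c'; have [c ecc'] := e_totl c'; exists (exist _ (c, c') ecc').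
have [i|g gx vg] := stab_homogeneous x_inj cu cv; first by rewrite ux vx.
exists g => // c c'; split=> [ecc'|[z <- <-]].
  have [z uz] := cu.2 (exist _ (c, c') ecc').
  by exists z; [rewrite -eu /= uz|rewrite -ev /= -/((v \o hfun g) z) vg uz].
rewrite -eu -ev /= -/((v \o hfun g) z) vg; exact: (valP (u z)).
Qed.

(** * Marked graphs and amalgamation *)

(* [(j, true)] stands for the j-th generator of the free group of rank [m] and
   [(j, false)] for its inverse. *)
Definition dir m := ('I_m * bool)%type.

Definition dir_inv m (d : dir m) : dir m := (d.1, ~~ d.2).

Lemma dir_invK m : involutive (@dir_inv m).
Proof. by case=> j b; rewrite /dir_inv /= negbK. Qed.

Section MarkedGraphs.
Variables n m : nat.

Record marked_graph_axioms (A : finType) (e : dir m -> rel A) (p : 'I_n -> A) :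
    Prop := MarkedGraphAxioms {
  axiom_edge_inv : forall d a b, e (dir_inv d) b a = e d a b;
  axiom_edge_total : forall d a, exists b, e d a b;
  axiom_edge_mark : forall d i, e d (p i) (p i) }.

Record marked_graph := MarkedGraph {
  vertex :> finType;
  edge : dir m -> rel vertex;
  mark : 'I_n -> vertex;
  marked_graphP : marked_graph_axioms edge mark }.
Arguments edge {A} d a b : rename.
Arguments mark {A} i : rename.
Implicit Types A B C D E : marked_graph.

Lemma edge_inv A d (a b : A) : edge (dir_inv d) b a = edge d a b.
Proof. exact: axiom_edge_inv (marked_graphP A) d a b. Qed.

Lemma edge_total A d (a : A) : exists b, edge d a b.
Proof. exact: axiom_edge_total (marked_graphP A) d a. Qed.

Lemma edge_mark A d i : edge d (mark i : A) (mark i).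
Proof. exact: axiom_edge_mark (marked_graphP A) d i. Qed.

Record epimorphism C A (phi : C -> A) : Prop := Epimorphism {
  epi_edge : forall d c c', edge d c c' -> edge d (phi c) (phi c');
  epi_surj : surjective phi;
  epi_edge_lift : forall d a a', edge d a a' ->
    exists c c', [/\ edge d c c', phi c = a & phi c' = a'];
  epi_mark : forall i, phi (mark i) = mark i }.

Lemma epimorphism_comp A B C (f : B -> A) (g : C -> B) :
  epimorphism f -> epimorphism g -> epimorphism (f \o g).
Proof.
move=> epi_f epi_g; split=> /=.
- by move=> d c c' /(epi_edge epi_g) /(epi_edge epi_f).
- move=> a; have [b <-] := epi_surj epi_f a.
  by have [c <-] := epi_surj epi_g b; exists c.
- move=> d a a' /(epi_edge_lift epi_f)[b [b' [bb' <- <-]]].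
  by have [c [c' [cc' <- <-]]] := epi_edge_lift epi_g bb'; exists c, c'.
- by move=> i; rewrite (epi_mark epi_g) (epi_mark epi_f).
Qed.

Definition isomorphic A B := exists (f : A -> B) (g : B -> A),
  [/\ cancel f g, cancel g f, epimorphism f & epimorphism g].

Lemma bijection_isomorphic A B (f : A -> B) (g : B -> A) :
  cancel f g -> cancel g f -> (forall d, {mono f : a a' / edge d a a'}) ->
  (forall i, f (mark i) = mark i) -> isomorphic A B.
Proof.
move=> fK gK f_edge f_mark; exists f, g; split=> //; split=> //.
- by move=> d a a'; rewrite f_edge.
- by move=> b; exists (g b).
- by move=> d b b' bb'; exists (g b), (g b'); rewrite -f_edge !gK.
- by move=> d b b'; rewrite -{1}[b]gK -{1}[b']gK f_edge.
- by move=> a; exists (f a).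
- by move=> d a a' aa'; exists (f a), (f a'); rewrite f_edge !fK.
- by move=> i; rewrite -f_mark fK.
Qed.

Definition amalgamation_base A :=
  forall C D (phi : C -> A) (psi : D -> A),
  epimorphism phi -> epimorphism psi ->
  exists E (f : E -> C) (g : E -> D),
    [/\ epimorphism f, epimorphism g & phi \o f =1 psi \o g].

Lemma amalgamation_base_isomorphic A B :
  isomorphic A B -> amalgamation_base A -> amalgamation_base B.
Proof.
move=> [f [g [fK gK epi_f epi_g]]] baseA C D phi psi epi_phi epi_psi.
have [E [f1 [g1 [epi_f1 epi_g1 fg]]]] := baseA _ _ _ _
  (epimorphism_comp epi_g epi_phi) (epimorphism_comp epi_g epi_psi).
by exists E, f1, g1; split=> // e; apply/(can_inj gK)/fg.
Qed.

Lemma exists_subproduct C D (Z : {set C * D}) :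
  (forall i, (mark i, mark i) \in Z) ->
  (forall d c b, (c, b) \in Z ->
    exists c' b', [/\ (c', b') \in Z, edge d c c' & edge d b b']) ->
  (forall c, exists b, (c, b) \in Z) -> (forall b, exists c, (c, b) \in Z) ->
  (forall d c c', edge d c c' ->
    exists b b', [/\ (c, b) \in Z, (c', b') \in Z & edge d b b']) ->
  (forall d b b', edge d b b' ->
    exists c c', [/\ (c, b) \in Z, (c', b') \in Z & edge d c c']) ->
  exists E (f : E -> C) (g : E -> D),
    [/\ epimorphism f, epimorphism g & forall e, (f e, g e) \in Z].
Proof.
move=> Z_mark Z_total Z_vertexl Z_vertexr Z_edgel Z_edger.
pose V : finType := {p | p \in Z}.
pose e d (p p' : V) :=
  edge d (val p).1 (val p').1 && edge d (val p).2 (val p').2.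
have graphV :
    marked_graph_axioms e (fun i => exist _ (mark i, mark i) (Z_mark i)).
  split=> [d p p'|d [[c b] cbZ]|d i]; rewrite /e /=.
  - by rewrite !edge_inv.
  - have [c' [b' [c'b'Z cc' bb']]] := Z_total d c b cbZ.
    by exists (exist _ (c', b') c'b'Z); rewrite /= cc' bb'.
  - by rewrite !edge_mark.
exists (MarkedGraph graphV), (fun p => (val p).1), (fun p => (val p).2); split.
- split=> //= [d p p' /andP[]//|c|d c c' cc'].
    by have [b cbZ] := Z_vertexl c; exists (exist _ (c, b) cbZ).
  have [b [b' [cbZ c'b'Z bb']]] := Z_edgel d c c' cc'.
  exists (exist _ (c, b) cbZ), (exist _ (c', b') c'b'Z).
  by rewrite /e /= cc' bb'.
- split=> //= [d p p' /andP[]//|b|d b b' bb'].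
    by have [c cbZ] := Z_vertexr b; exists (exist _ (c, b) cbZ).
  have [c [c' [cbZ c'b'Z cc']]] := Z_edger d b b' bb'.
  exists (exist _ (c, b) cbZ), (exist _ (c', b') c'b'Z).
  by rewrite /e /= cc' bb'.
- by case=> -[c b].
Qed.

(* [back a] is the direction from [a] towards the root, if there is one; in all
   other directions [a] has a single neighbor, lying further away from the
   root. *)
Record rooting A (back : A -> option (dir m)) : Prop := Rooting {
  rooting_uniq : forall d a b b', back a != Some d ->
    edge d a b -> edge d a b' -> b = b';
  rooting_away : forall d a b, back a != Some d -> edge d a b ->
    back b = None \/ back b = Some (dir_inv d);
  rooting_back : forall d a b, back a = Some d -> edge d a b ->
    back b != Some (dir_inv d) }.

Section RootedPullback.
Variables (A : marked_graph) (back : A -> option (dir m)).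
Hypothesis rootingA : rooting back.

Section CommonPaths.
Variables (C D : marked_graph) (phi : C -> A) (psi : D -> A).

Definition prepend_back_edge (Z : {set C * D}) : {set C * D} :=
  [set p : C * D | (phi p.1 == psi p.2) &&
    if back (phi p.1) is Some d
    then [exists p' in Z, edge d p.1 p'.1 && edge d p.2 p'.2] else true]%SET.

(* The pairs in the pullback from which there is an infinite common path
   heading back to the root, or a finite one reaching it. *)
Definition back_paths : {set C * D} := cofixset prepend_back_edge.

Lemma prepend_back_edge_mono :
  {homo prepend_back_edge : Z Z' / Z \subset Z'}.
Proof.
move=> Z Z' ZZ'; apply/fintype.subsetP => p; rewrite !inE => /andP[-> /=].
case: (back _) => // d /existsP[p' /andP[/(fintype.subsetP ZZ') p'Z' dp']].
by apply/existsP; exists p'; rewrite p'Z'.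
Qed.

Lemma back_pathsE :
  back_paths = iter #|{: C * D}| prepend_back_edge [set: C * D]%SET.
Proof.
rewrite /back_paths /cofixset /fixset.
elim: #|_| => [|k IH] /=; first exact: finset.setC0.
by rewrite -IH /funsetC finset.setCK.
Qed.

Lemma back_pathsP c b : (c, b) \in back_paths <-> phi c = psi b /\
  forall d, back (phi c) = Some d ->
    exists c' b', [/\ (c', b') \in back_paths, edge d c c' & edge d b b'].
Proof.
rewrite {1}/back_paths -(cofixsetK prepend_back_edge_mono) -/back_paths inE /=.
split=> [/andP[/eqP-> h]|[-> h]].
  split=> // d back_c; move: h; rewrite back_c.
  by move=> /existsP[[c' b'] /and3P[? ? ?]]; exists c', b'.
rewrite eqxx /=; case: (back _) h => // d /(_ d erefl)[c' [b' [cbZ cc' bb']]].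
by apply/existsP; exists (c', b'); rewrite cbZ cc'.
Qed.

End CommonPaths.

Lemma back_paths_swap C D (phi : C -> A) (psi : D -> A) c b :
  ((c, b) \in back_paths phi psi) = ((b, c) \in back_paths psi phi).
Proof.
rewrite !back_pathsE card_prod [in RHS]card_prod mulnC.
elim: (_ * _) c b => [|k IH] c b /=; rewrite !inE //=.
case: eqP => [->|ne]; last by rewrite eq_sym (introF eqP ne).
rewrite eqxx /=; case: (back _) => // d.
by apply/existsP/existsP=> -[[c' b'] /and3P[/= ? ? ?]];
  exists (b', c'); apply/and3P; split=> //; rewrite /= ?IH // -IH.
Qed.

Section RootedAmalgam.
Variables (C D : marked_graph) (phi : C -> A) (psi : D -> A).
Hypotheses (epi_phi : epimorphism phi) (epi_psi : epimorphism psi).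
Local Notation back_paths := (back_paths phi psi).

Lemma edge_away_match d c b c' b' : phi c = psi b -> back (phi c) != Some d ->
  edge d c c' -> edge d b b' -> phi c' = psi b'.
Proof.
move=> phi_c away /(epi_edge epi_phi) cc' /(epi_edge epi_psi).
by rewrite -phi_c; exact: rooting_uniq away cc'.
Qed.

Lemma back_paths_away d c b c' b' : (c, b) \in back_paths ->
  back (phi c) != Some d -> edge d c c' -> edge d b b' ->
  (c', b') \in back_paths.
Proof.
move=> cbZ away cc' bb'; have [phi_c _] := (back_pathsP phi psi c b).1 cbZ.
apply/back_pathsP; split=> [|e back_c'].
  exact: edge_away_match away cc' bb'.
exists c, b; have := rooting_away rootingA away (epi_edge epi_phi cc').
by rewrite back_c' => -[//|[->]]; rewrite !edge_inv.
Qed.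

Lemma back_paths_total d c b : (c, b) \in back_paths ->
  exists c' b', [/\ (c', b') \in back_paths, edge d c c' & edge d b b'].
Proof.
move=> cbZ; have [towards|away] := eqVneq (back (phi c)) (Some d).
  by have [_] := (back_pathsP phi psi c b).1 cbZ; exact.
have [c' cc'] := edge_total d c; have [b' bb'] := edge_total d b.
by exists c', b'; split=> //; exact: back_paths_away cbZ away cc' bb'.
Qed.

(* A path towards the root lifts from its far end, since on the way back from
   there everything is determined. *)
Lemma back_paths_vertex c : exists b, (c, b) \in back_paths.
Proof.
suff [b _ cbZ] : exists2 b, phi c = psi b & (c, b) \in back_paths by exists b.
rewrite back_pathsE; elim: #|_| c => [|k IH] c.
  by have [b psi_b] := epi_surj epi_psi (phi c); exists b; rewrite ?inE.
case back_c: (back (phi c)) => [d|]; last first.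
  have [b psi_b] := epi_surj epi_psi (phi c); exists b => //.
  by rewrite inE /= back_c psi_b eqxx.
have [c' cc'] := edge_total d c; have [b' phi_c' c'b'Z] := IH c'.
have [b b'b] := edge_total (dir_inv d) b'.
have away := rooting_back rootingA back_c (epi_edge epi_phi cc').
have c'c : edge (dir_inv d) c' c by rewrite edge_inv.
have phi_c := edge_away_match phi_c' away c'c b'b; exists b => //.
rewrite inE /= back_c -phi_c eqxx; apply/existsP; exists (c', b').
by rewrite c'b'Z cc' /= -edge_inv b'b.
Qed.

Lemma back_paths_edge d c c' : edge d c c' ->
  exists b b',
    [/\ (c, b) \in back_paths, (c', b') \in back_paths & edge d b b'].
Proof.
move=> cc'; have [towards|away] := eqVneq (back (phi c)) (Some d); last first.
  have [b cbZ] := back_paths_vertex c; have [b' bb'] := edge_total d b.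
  by exists b, b'; split=> //; exact: back_paths_away cbZ away cc' bb'.
have away := rooting_back rootingA towards (epi_edge epi_phi cc').
have [b' c'b'Z] := back_paths_vertex c'.
have [b b'b] := edge_total (dir_inv d) b'.
exists b, b'; split=> //; last by rewrite -edge_inv.
by apply: back_paths_away c'b'Z away _ b'b; rewrite edge_inv.
Qed.

Lemma back_paths_mark i : (mark i, mark i) \in back_paths.
Proof.
rewrite back_pathsE; elim: #|_| => [|k IH]; rewrite inE //=.
rewrite (epi_mark epi_phi) (epi_mark epi_psi) eqxx; case: (back _) => // d.
by apply/existsP; exists (mark i, mark i); rewrite IH !edge_mark.
Qed.

End RootedAmalgam.

Lemma rooting_amalgamation_base : amalgamation_base A.
Proof.
move=> C D phi psi epi_phi epi_psi.
have [||||||E [f [g [epi_f epi_g fgZ]]]] :=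
    exists_subproduct (Z := back_paths phi psi).
- exact: back_paths_mark.
- exact: back_paths_total.
- exact: back_paths_vertex.
- move=> b; have [c bcZ] := back_paths_vertex epi_psi epi_phi b.
  by exists c; rewrite back_paths_swap.
- exact: back_paths_edge.
- move=> d b b' /(back_paths_edge epi_psi epi_phi)[c [c' [bc b'c' cc']]].
  by exists c, c'; rewrite ![(_, _) \in back_paths phi psi]back_paths_swap.
- exists E, f, g; split=> // e.
  by have [] := (back_pathsP _ _ _ _).1 (fgZ e).
Qed.

End RootedPullback.

Lemma point_axioms : @marked_graph_axioms unit (fun _ _ _ => true) (fun=> tt).
Proof. by split=> //; exists tt. Qed.

Definition point := MarkedGraph point_axioms.

Lemma amalgamation_base_point : amalgamation_base point.
Proof.
apply: (@rooting_amalgamation_base point (fun=> None)).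
by split=> // [d [] [] []|d a b _ _]; [|left].
Qed.

Section Unfolding.
Variable A : marked_graph.

Definition neighbor (a : A) d : A := sval (cid (edge_total d a)).

Lemma edge_neighbor a d : edge d a (neighbor a d).
Proof. exact: (svalP (cid (edge_total d a))). Qed.

(* All neighbors of [Origin a f] are prescribed by [f] (with [neighbor] as a
   fallback for inadmissible values of [f]); those of [Outer a e] are prescribed
   by [neighbor], except in the direction [e] leading back to an origin. *)
Inductive unfolding_vertex :=
  | Origin of A & {ffun dir m -> A}
  | Outer of A & dir m
  | Isolated of 'I_n.

Definition unfolding_vertex_encode (b : unfolding_vertex) :
    A * {ffun dir m -> A} + A * dir m + 'I_n :=
  match b with
  | Origin a f => inl (inl (a, f))
  | Outer a e => inl (inr (a, e))
  | Isolated i => inr i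
  end.

Definition unfolding_vertex_decode
    (b : A * {ffun dir m -> A} + A * dir m + 'I_n) : unfolding_vertex :=
  match b with
  | inl (inl (a, f)) => Origin a f
  | inl (inr (a, e)) => Outer a e
  | inr i => Isolated i
  end.

Lemma unfolding_vertex_encodeK :
  cancel unfolding_vertex_encode unfolding_vertex_decode.
Proof. by case. Qed.

HB.instance Definition _ :=
  Finite.copy unfolding_vertex (can_type unfolding_vertex_encodeK).

Definition unfolding_step d (b : unfolding_vertex) : option unfolding_vertex :=
  match b with
  | Origin a f =>
      Some (Outer (if edge d a (f d) then f d else neighbor a d) (dir_inv d))
  | Outer a e =>
      if d == e then None else Some (Outer (neighbor a d) (dir_inv d))
  | Isolated i => Some (Isolated i)
  end.

Definition unfolding_edge d (b b' : unfolding_vertex) :=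
  (unfolding_step d b == Some b') || (unfolding_step (dir_inv d) b' == Some b).

Definition unfolding_proj (b : unfolding_vertex) : A :=
  match b with Origin a _ => a | Outer a _ => a | Isolated i => mark i end.

Definition unfolding_back (b : unfolding_vertex) : option (dir m) :=
  if b is Outer _ e then Some e else None.

Lemma unfolding_axioms : marked_graph_axioms unfolding_edge Isolated.
Proof.
split=> [d b b'|d b|d i]; rewrite /unfolding_edge.
- by rewrite dir_invK orbC.
- case: b => [a f|a e|i].
  + by eexists; apply/orP; left; exact: eqxx.
  + have [->|de] := eqVneq d e; last first.
      by eexists; apply/orP; left; rewrite /= (negPf de); exact: eqxx.
    exists (Origin (neighbor a e) [ffun=> a]); apply/orP; right => /=.
    by rewrite ffunE edge_inv edge_neighbor dir_invK.
  + by exists (Isolated i); rewrite eqxx.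
- by rewrite eqxx.
Qed.

Definition unfolding := MarkedGraph unfolding_axioms.

Lemma unfolding_proj_step d b b' :
  unfolding_step d b = Some b' -> edge d (unfolding_proj b) (unfolding_proj b').
Proof.
case: b => [a f|a e|i] /=.
- by move=> [<-] /=; case: ifP => // _; exact: edge_neighbor.
- by case: eqP => // _ [<-] /=; exact: edge_neighbor.
- by move=> [<-]; exact: edge_mark.
Qed.

Lemma unfolding_proj_epimorphism :
  epimorphism (unfolding_proj : unfolding -> A).
Proof.
split=> //.
- move=> d b b' /orP[/eqP/unfolding_proj_step//|/eqP/unfolding_proj_step].
  by rewrite edge_inv.
- by move=> a; exists (Origin a [ffun=> a]).
- move=> d a a' aa'.
  exists (Origin a [ffun=> a']), (Outer a' (dir_inv d)); split=> //.
  by apply/orP; left; rewrite /= ffunE aa'.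
Qed.

Lemma unfolding_step_back d b :
  unfolding_step d b = None <-> unfolding_back b = Some d.
Proof.
case: b => [a f|a e|i] //=.
by have [->|ne] := eqVneq d e; split=> // -[ed]; rewrite ed eqxx in ne.
Qed.

Lemma unfolding_step_uniq d (b b' b'' : unfolding) :
  unfolding_step d b = Some b' -> edge d b b'' -> b'' = b'.
Proof.
move=> step_b /orP[|]; first by rewrite step_b => /eqP[].
case: b'' => [a f|a e|i] /=.
- by move=> /eqP[bE]; move: step_b; rewrite -bE /= dir_invK eqxx.
- by case: ifP => // _ /eqP[bE]; move: step_b; rewrite -bE /= dir_invK eqxx.
- by move=> /eqP[bE]; move: step_b; rewrite -bE /= => -[].
Qed.

Lemma unfolding_step_target d b b' : unfolding_step d b = Some b' ->
  unfolding_back b' = None \/ unfolding_back b' = Some (dir_inv d).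
Proof.
case: b => [a f|a e|i] /=; last by move=> [<-]; left.
- by move=> [<-]; right.
- by case: eqP => // _ [<-]; right.
Qed.

Lemma unfolding_rooting : rooting (unfolding_back : unfolding -> _).
Proof.
have away_step d (b : unfolding) :
    unfolding_back b != Some d -> exists b', unfolding_step d b = Some b'.
  case step_b: (unfolding_step d b) => [b'|]; first by exists b'.
  by have /unfolding_step_back -> := step_b; rewrite eqxx.
split=> [d b b' b'' /away_step[v step_b]|d b b' /away_step[v step_b]|d b b'].
- by move=> /(unfolding_step_uniq step_b)-> /(unfolding_step_uniq step_b)->.
- move=> /(unfolding_step_uniq step_b)->.
  exact: unfolding_step_target step_b.
- move=> /unfolding_step_back step_b /orP[|/eqP step_b'].
    by rewrite step_b.
  by apply/eqP => /unfolding_step_back; rewrite step_b'.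
Qed.

Lemma amalgamation_base_unfolding : amalgamation_base unfolding.
Proof. exact: rooting_amalgamation_base unfolding_rooting. Qed.

End Unfolding.

(** * Countably many marked graphs *)

Definition graph_code := {r : nat &
  {c : {ffun dir m * 'I_r * 'I_r -> bool} * {ffun 'I_n -> 'I_r} |
    `[< marked_graph_axioms (fun d a b => c.1 (d, a, b)) c.2 >]}}.

Definition graph_decode (c : graph_code) : marked_graph :=
  MarkedGraph (asboolW (valP (tagged c))).

Lemma graph_decode_onto A : exists c, isomorphic A (graph_decode c).
Proof.
pose e := [ffun k : dir m * 'I_#|A| * 'I_#|A| =>
  edge k.1.1 (enum_val k.1.2 : A) (enum_val k.2)].
pose p := [ffun i => enum_rank (mark i : A)].
have codeP : `[< marked_graph_axioms (fun d a b => e (d, a, b)) p >].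
  apply/asboolP; split=> [d a b|d a|d i]; rewrite ?ffunE /=.
  - exact: edge_inv.
  - have [b ab] := edge_total d (enum_val a : A).
    by exists (enum_rank b); rewrite ffunE enum_rankK.
  - by rewrite enum_rankK edge_mark.
pose c : graph_code := existT _ #|A| (exist _ (e, p) codeP); exists c.
apply: (@bijection_isomorphic A (graph_decode c) enum_rank enum_val).
- exact: enum_rankK.
- exact: enum_valK.
- by move=> d a a'; rewrite /= ffunE /= !enum_rankK.
- by move=> i; rewrite /= ffunE.
Qed.

End MarkedGraphs.

Arguments edge {n m A} d a b : rename.
Arguments mark {n m A} i : rename.

(** * Realization of marked graphs by tuples of homeomorphisms *)

Definition homeo_id : homeo :=
  @Homeo id id (fun=> cvg_id) (fun=> cvg_id) (fun=> erefl) (fun=> erefl).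

Definition act m (t : 'I_m -> homeo) (d : dir m) (z : Cantor) : Cantor :=
  if d.2 then hfun (t d.1) z else hinv (t d.1) z.

Lemma actK m (t : 'I_m -> homeo) d : cancel (act t d) (act t (dir_inv d)).
Proof. by case: d => j [] z; rewrite /act /= ?hfunK ?hinvK. Qed.

Lemma actVK m (t : 'I_m -> homeo) d : cancel (act t (dir_inv d)) (act t d).
Proof. by move=> z; rewrite -{1}[d]dir_invK actK. Qed.

Lemma act_continuous m (t : 'I_m -> homeo) d : continuous (act t d).
Proof. by case: d => j [] z; [exact: hfun_cont|exact: hinv_cont]. Qed.

Section Realization.
Variables (n : nat) (x : 'I_n -> Cantor) (m : nat).
Local Notation marked_graph := (marked_graph n m).
Local Notation tuples := (@tuples n x m).
Implicit Types (t s : 'I_m -> homeo) (A B C D E : marked_graph).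

Lemma act_stab t d i : tuples t -> act t d (x i) = x i.
Proof.
move=> tx; case: d => j [] /=; rewrite /act /= ?tx //.
by rewrite -{1}(tx j i) hfunK.
Qed.

Record realizes t A (q : Cantor -> A) : Prop := Realizes {
  realizes_coloring : coloring q;
  realizes_mark : forall i, q (x i) = mark i;
  realizes_edge : forall d a a',
    edge d a a' <-> exists2 z, q z = a & q (act t d z) = a' }.

Lemma realizes_generators t A (q : Cantor -> A) :
  coloring q -> (forall i, q (x i) = mark i) ->
  (forall j a a', edge (j, true) a a' <->
     exists2 z, q z = a & q (hfun (t j) z) = a') ->
  realizes t q.
Proof.
move=> cq qx q_edge; split=> // -[j []] a a'; first exact: q_edge.
rewrite -edge_inv; split=> [/q_edge[z za za']|[z za za']].
  by exists (hfun (t j) z); rewrite // /act /= hfunK.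
by apply/q_edge; exists (hinv (t j) z); rewrite ?hinvK.
Qed.

Lemma realizes_edge_act t A (q : Cantor -> A) d z :
  realizes t q -> edge d (q z) (q (act t d z)).
Proof. by move=> tq; apply/(realizes_edge tq); exists z. Qed.

Lemma realizes_point t : realizes t (fun=> tt : point n m).
Proof.
split=> //; first by split; [exists 0|case; exists (fun=> false)].
by move=> d [] []; split=> // _; exists (fun=> false).
Qed.

Lemma exists_realizes t (T : finType) (u : Cantor -> T) :
  tuples t -> locally_constant u ->
  exists A (q : Cantor -> A) (f : A -> T), realizes t q /\ f \o q =1 u.
Proof.
move=> tx /locally_constant_image[A [q [f [cq fq]]]].
pose e d (a a' : A) := `[< exists2 z, q z = a & q (act t d z) = a' >].
have graphA : @marked_graph_axioms n m A e (q \o x).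
  split=> [d a a'|d a|d i].
  - apply/asbool_equiv_eq; split=> -[z <- <-].
      by exists (act t (dir_inv d) z); rewrite ?actVK.
    by exists (act t d z); rewrite ?actK.
  - have [z <-] := cq.2 a; exists (q (act t d z)); apply/asboolP.
    by exists z.
  - by apply/asboolP; exists (x i); rewrite ?act_stab.
exists (MarkedGraph graphA), q, f; split=> //; split=> //= d a a'.
by split=> /asboolP.
Qed.

Lemma realizes_comp t A B (q : Cantor -> A) (f : A -> B) :
  realizes t q -> epimorphism f -> realizes t (f \o q).
Proof.
move=> tq epi_f; have [lq sq] := realizes_coloring tq; split.
- split; first exact: locally_constant_comp.
  by move=> b; have [a <-] := epi_surj epi_f b; have [z <-] := sq a; exists z.
- by move=> i /=; rewrite (realizes_mark tq) (epi_mark epi_f).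
- move=> d b b'; split=> [/(epi_edge_lift epi_f)[a [a' [aa' <- <-]]]|[z <- <-]].
    by have /(realizes_edge tq)[z <- <-] := aa'; exists z.
  exact/(epi_edge epi_f)/realizes_edge_act.
Qed.

Lemma realizes_epimorphism t A C (q : Cantor -> A) (q' : Cantor -> C)
    (phi : C -> A) :
  realizes t q -> realizes t q' -> phi \o q' =1 q -> epimorphism phi.
Proof.
move=> tq tq' phi_q'; have {}phi_q' z : phi (q' z) = q z := phi_q' z; split.
- move=> d c c' /(realizes_edge tq')[z <- <-]; rewrite !phi_q'.
  exact: realizes_edge_act.
- by move=> a; have [z <-] := (realizes_coloring tq).2 a; exists (q' z).
- move=> d a a' /(realizes_edge tq)[z <- <-]; exists (q' z), (q' (act t d z)).
  by split=> //; exact: realizes_edge_act.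
- by move=> i; rewrite -(realizes_mark tq') -(realizes_mark tq).
Qed.

Hypothesis x_inj : injective x.

Lemma realizes_lift t A C (q : Cantor -> A) (phi : C -> A) :
  realizes t q -> epimorphism phi -> exists t' (q' : Cantor -> C),
    [/\ tuples t', realizes t' q' & phi \o q' =1 q].
Proof.
move=> tq epi_phi.
have [i|q' [cq' phi_q' q'x]] :=
    coloring_lift (p := mark) x_inj (realizes_coloring tq) (epi_surj epi_phi).
  by rewrite /= (epi_mark epi_phi) (realizes_mark tq).
have /choice[t' t'P] (j : 'I_m) : exists g, stab x g /\ forall c c',
    edge (j, true) c c' <-> exists2 z, q' z = c & q' (hfun g z) = c'.
  have [||i|g gx gP] := @stab_realizes_rel _ x _ (edge (j, true)) q' x_inj cq'.
  - exact: edge_total.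
  - move=> c; have [c' cc'] := edge_total (j, false) c.
    by exists c'; rewrite -edge_inv.
  - by rewrite (q'x i : q' _ = _); exact: edge_mark.
  - by exists g.
exists t', q'; split=> //; first by move=> j; have [] := t'P j.
by apply: realizes_generators => // j; have [] := t'P j.
Qed.

Lemma gopen_realizes A (q : Cantor -> A) :
  gopen x [set t | tuples t /\ realizes t q].
Proof.
split=> [t []//|t [tx tq]]; have [lq _] := realizes_coloring tq.
exists #|A|, (fun i => q @^-1` [set enum_val i]); split.
  move=> i; apply/clopen_locally_constantP.
  exact: (@locally_constant_comp _ _ _ (fun a => a = enum_val i) lq).
move=> s [sx st]; split=> //; apply: realizes_generators.
- exact: realizes_coloring tq.
- exact: realizes_mark tq.
move=> j a a'; rewrite (realizes_edge tq) /act /=; have := st j (enum_rank a).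
rewrite enum_rankK => /seteqP[sub_st sub_ts]; split=> -[z za za'].
  by have [|y ya e] := sub_ts (hfun (t j) z); [exists z|exists y; rewrite ?e].
by have [|y ya e] := sub_st (hfun (s j) z); [exists z|exists y; rewrite ?e].
Qed.

Definition follows T (u : Cantor -> T) t s :=
  forall j z, exists2 y, u y = u z & u (hfun (t j) y) = u (hfun (s j) z).

Lemma follows_comp T T' (u : Cantor -> T') t s (q : Cantor -> T) (f : T -> T') :
  f \o q =1 u -> follows q t s -> follows u t s.
Proof.
move=> fq q_follows j z; have [y qy qty] := q_follows j z.
by exists y; rewrite -!fq /= ?qy ?qty.
Qed.

Lemma follows_realizes t s A (q : Cantor -> A) :
  realizes t q -> (forall j z, edge (j, true) (q z) (q (hfun (s j) z))) ->
  follows q t s.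
Proof. by move=> tq q_edge j z; have /(realizes_edge tq) := q_edge j z. Qed.

Lemma gopen_follows U t : gopen x U -> U t ->
  exists (T : finType) (u : Cantor -> T), locally_constant u /\
    forall s, tuples s -> follows u t s -> U s.
Proof.
move=> [_ U_open] /U_open[k [cs [clopen_cs csU]]].
pose u z := ([ffun i => `[< cs i z >]],
  [ffun ij : 'I_k * 'I_m => `[< cs ij.1 (hinv (t ij.2) z) >]]).
have l_cs i : locally_constant (fun z => `[< cs i z >]).
  by apply: locally_constant_comp; exact/clopen_locally_constantP.
exists _, u; split.
  apply: locally_constant_pair; apply: locally_constant_ffun => // -[i j] /=.
  exact: locally_constant_comp_continuous (@hinv_cont (t j)) (l_cs i).
move=> s sx s_follows; apply: csU; split=> // j i.
have csE z : cs i z <-> cs i (hinv (t j) (hfun (s j) z)).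
  have [y [/ffunP/(_ i) + _] [_ /ffunP/(_ (i, j))]] := s_follows j z.
  rewrite !ffunE /= hfunK => yz ysz.
  by apply: asbool_eq_equiv; rewrite -yz ysz.
apply/seteqP; split=> y [z cz <-].
  by exists (hinv (t j) (hfun (s j) z)); rewrite ?hinvK //; exact: (csE z).1.
exists (hinv (s j) (hfun (t j) z)); rewrite ?hinvK //.
by apply: (csE _).2; rewrite hinvK hfunK.
Qed.

(** * Baire category *)

Lemma gmeagre_sub (M N : set ('I_m -> homeo)) :
  M `<=` N -> gmeagre x N -> gmeagre x M.
Proof.
by move=> MN [W [W_nd NW]]; exists W; split=> //; exact: subset_trans NW.
Qed.

Lemma gmeagre_bigcup (I : countType) (N : I -> set ('I_m -> homeo)) :
  (forall i, gnowhere_dense x (N i)) -> gmeagre x (\bigcup_i N i).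
Proof.
move=> N_nd.
exists (fun k => if unpickle k is Some i then N i else set0); split.
  move=> k; case: unpickle => [i|]; first exact: N_nd.
  by move=> U oU U0; exists U; split=> //; exact: setI0.
by move=> t [i _ Nit]; exists (pickle i); rewrite ?pickleK.
Qed.

Lemma gnowhere_denseI (N : set ('I_m -> homeo)) :
  (forall U t, gopen x U -> U t -> N t ->
    exists V, [/\ gopen x V, V !=set0, V `<=` U & V `<=` ~` N]) ->
  gnowhere_dense x N.
Proof.
move=> N_nd U oU U0; have [[t [Ut Nt]]|UN0] := pselect (U `&` N !=set0).
  have [V [oV V0 VU VN]] := N_nd U t oU Ut Nt.
  by exists V; split=> //; apply/disjoints_subset.
by exists U; split=> //; apply/nonemptyPn.
Qed.

Record approximation := Approximation {
  approx_graph : marked_graph;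
  approx_coloring : Cantor -> approx_graph;
  approx_tuple : 'I_m -> homeo;
  approx_stab : tuples approx_tuple;
  approx_realizes : realizes approx_tuple approx_coloring }.

Definition approx_refines l (a b : approximation) :=
  [/\ exists2 f : approx_graph b -> approx_graph a,
        f \o approx_coloring b =1 approx_coloring a & epimorphism f,
      resolves l (approx_coloring b) &
      forall d z y, approx_coloring b z = approx_coloring b y ->
        agree l (act (approx_tuple b) d z) (act (approx_tuple b) d y)].

Definition approx_avoids (N : set ('I_m -> homeo)) (a : approximation) :=
  forall s, tuples s -> follows (approx_coloring a) (approx_tuple a) s -> ~ N s.

Lemma exists_approx_refines N l a : gnowhere_dense x N ->
  exists b, approx_refines l a b /\ approx_avoids N b.
Proof.
case: a => A q t tx tq N_nd.
have [|V [oV [t' Vt'] V_realizes VN0]] := N_nd _ (gopen_realizes q).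
  by exists t.
have [t'x t'q] := V_realizes _ Vt'.
have [T [u [lu uV]]] := gopen_follows oV Vt'.
pose w z := [ffun d => truncate l (act t' d z)].
have lw : locally_constant w.
  apply: locally_constant_ffun => d.
  exact: locally_constant_comp_continuous (@act_continuous _ t' d)
    (locally_constant_truncate l).
have [B [p [f [t'p fp]]]] := exists_realizes t'x
  (locally_constant_pair (locally_constant_pair lu (realizes_coloring t'q).1)
     (locally_constant_pair (locally_constant_truncate l) lw)).
exists (Approximation t'x t'p); split; first split=> /=.
- have fq : (fun b => (f b).1.2) \o p =1 q by move=> z; have /= -> := fp z.
  by exists (fun b => (f b).1.2) => //; exact: realizes_epimorphism t'q t'p fq.
- move=> z y zy; apply/truncate_eqP.
  by have := fp z; have := fp y; rewrite /= zy => -> [].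
- move=> d z y zy; apply/truncate_eqP.
  have := fp z; have := fp y; rewrite /= zy => -> [_ _ _ /ffunP/(_ d)].
  by rewrite !ffunE.
- move=> s sx /= s_follows Ns; suff : (V `&` N) s by rewrite VN0.
  have fu : (fun b => (f b).1.1) \o p =1 u by move=> z; have /= -> := fp z.
  by split=> //; apply: uV => //; exact: follows_comp fu s_follows.
Qed.

Lemma approx_limit (S : nat -> approximation) :
  (forall k, approx_refines k.+1 (S k) (S k.+1)) ->
  exists2 t, tuples t &
    forall k, follows (approx_coloring (S k)) (approx_tuple (S k)) t.
Proof.
move=> S_refines; pose q k := approx_coloring (S k).
have Sq k : realizes (approx_tuple (S k)) (q k) := approx_realizes (S k).
have cq k : coloring (q k) := realizes_coloring (Sq k).
have small k d a y y' : edge d a (q k y) -> edge d a (q k y') -> agree k y y'.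
  case: k a => [//|k] a; have [_ q_res t_res] := S_refines k.
  move=> /(realizes_edge (Sq k.+1))[w wa /q_res/agree_sym/agree_trans wy].
  move=> /(realizes_edge (Sq k.+1))[w' w'a /q_res wy'].
  by apply/wy/(agree_trans _ wy')/t_res; exact: (etrans wa).
have /choice[t tP] (j : 'I_m) : exists g, stab x g /\
    forall k z, edge (j, true) (q k z) (q k (hfun g z)).
  have [|||||g gP] := limit_homeo (e := fun k => edge (j, true)) cq cq.
  - move=> k z y; rewrite /q; have [[f fq epi_f] _ _] := S_refines k.
    by rewrite -!fq; exact: epi_edge.
  - by move=> k a; exact: edge_total.
  - move=> k b; have [a ba] := edge_total (j, false) b.
    by exists a; rewrite -edge_inv.
  - by move=> k a y y'; exact: small.
  - by move=> k b z z'; rewrite -!(edge_inv (j, true)); exact: small.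
  exists g; split=> [i|k z]; last exact: ((gP z _).1 erefl k).
  by apply/gP => k; rewrite (realizes_mark (Sq k)); exact: edge_mark.
exists t => [j|k]; first by have [] := tP j.
by apply: (follows_realizes (Sq k)) => j z; have [_ /(_ k z)] := tP j.
Qed.

Lemma gmeagre_complement_nonempty (M : set ('I_m -> homeo)) :
  gmeagre x M -> exists2 t, tuples t & ~ M t.
Proof.
move=> [N [N_nd MN]].
have id_stab : tuples (fun=> homeo_id) by [].
have [S [_ S_refines]] := indexed_dependent_choice
  (Approximation id_stab (realizes_point _))
  (fun k a => exists_approx_refines k.+1 a (N_nd k)).
have [t tx t_follows] := approx_limit (fun k => (S_refines k).1).
by exists t => // /MN[k _]; apply: (S_refines k).2.
Qed.

(** * Generic tuples *)

Definition amalgamation_base_at l t := exists A (q : Cantor -> A),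
  [/\ amalgamation_base A, realizes t q & resolves l q].

Definition extensible t A C (phi : C -> A) (q : Cantor -> A) :=
  exists2 q' : Cantor -> C, realizes t q' & phi \o q' =1 q.

Definition saturated t := forall A C (phi : C -> A) (q : Cantor -> A),
  amalgamation_base A -> epimorphism phi -> realizes t q -> extensible t phi q.

Definition rich t := (forall l, amalgamation_base_at l t) /\ saturated t.

Lemma gopen_realizes_lift U t (T : finType) (w : Cantor -> T) :
  gopen x U -> U t -> locally_constant w ->
  exists A (q : Cantor -> A) (f : A -> T), [/\ realizes t q, f \o q =1 w &
    forall C (phi : C -> A), epimorphism phi -> exists2 q' : Cantor -> C,
      phi \o q' =1 q & exists V,
      [/\ gopen x V, V !=set0, V `<=` U & V `<=` [set s | realizes s q']]].
Proof.
move=> oU Ut lw; have tx : tuples t by exact: oU.1 Ut.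
have [T' [u [lu uU]]] := gopen_follows oU Ut.
have [A [q [f [tq fq]]]] := exists_realizes tx (locally_constant_pair lu lw).
exists A, q, (fun a => (f a).2); split=> //.
  by move=> z; have /= -> := fq z.
move=> C phi epi_phi.
have [t' [q' [t'x t'q' phi_q']]] := realizes_lift tq epi_phi.
exists q' => //; exists [set s | tuples s /\ realizes s q']; split.
- exact: gopen_realizes.
- by exists t'.
- move=> s [sx sq']; apply: uU => //.
  have sq : realizes s q by rewrite -(funext phi_q'); exact: realizes_comp.
  have fu : (fun a => (f a).1) \o q =1 u by move=> z; have /= -> := fq z.
  apply: follows_comp fu _; apply: follows_realizes tq _ => j z.
  exact: (realizes_edge_act (j, true) z sq).
- by move=> s [].
Qed.

Lemma gnowhere_dense_not_amalgamation_base_at l :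
  gnowhere_dense x (~` amalgamation_base_at l).
Proof.
apply: gnowhere_denseI => U t oU Ut _.
have [A [q [f [tq fq lift]]]] :=
  gopen_realizes_lift oU Ut (locally_constant_truncate l).
have [q' q'q [V [oV V0 VU V_realizes]]] :=
  lift _ _ (unfolding_proj_epimorphism A).
exists V; split=> //; rewrite setCK => s /V_realizes sq'.
exists (unfolding A), q'; split=> //; first exact: amalgamation_base_unfolding.
by move=> z y zy; apply/truncate_eqP; rewrite -!fq /= -!q'q /= zy.
Qed.

Definition inextensible A C (phi : C -> A) (q : Cantor -> A) :
    set ('I_m -> homeo) :=
  [set t | [/\ amalgamation_base A, epimorphism phi, realizes t q &
     ~ extensible t phi q]].

Lemma gnowhere_dense_inextensible A C (phi : C -> A) (q : Cantor -> A) :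
  gnowhere_dense x (inextensible phi q).
Proof.
apply: gnowhere_denseI => U t oU Ut [baseA epi_phi tq _].
have [D [p [f [tp fp lift]]]] :=
  gopen_realizes_lift oU Ut (realizes_coloring tq).1.
have epi_f := realizes_epimorphism tq tp fp.
have [E [f1 [g1 [epi_f1 epi_g1 fg]]]] := baseA _ _ _ _ epi_phi epi_f.
have [e g1e [V [oV V0 VU V_realizes]]] := lift _ _ epi_g1.
exists V; split=> // s /V_realizes se [_ _ _]; apply.
exists (f1 \o e) => [|z]; first exact: realizes_comp se epi_f1.
by rewrite -fp /= -g1e; exact: fg.
Qed.

Definition extension_code := {c : graph_code n m * graph_code n m &
  ({ffun graph_decode c.2 -> graph_decode c.1} *
   {l : nat & {ffun {ffun 'I_l -> bool} -> graph_decode c.1}})%type}.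

Definition inextensible_code (c : extension_code) : set ('I_m -> homeo) :=
  let: existT cAC (phi, existT l f) := c in
  inextensible (phi : graph_decode cAC.2 -> graph_decode cAC.1)
    (f \o truncate l).

Lemma saturated_codes t : (forall c, ~ inextensible_code c t) -> saturated t.
Proof.
move=> t_ext A C phi q baseA epi_phi tq; apply: contrapT => not_ext.
have [cA isoA] := graph_decode_onto A; have [f [g [fK gK epi_f _]]] := isoA.
have [cC [_ [g' [_ _ _ epi_g']]]] := graph_decode_onto C.
have tfq := realizes_comp tq epi_f.
have [l [w wE]] := locally_constant_factor (realizes_coloring tfq).1.
pose phi' := [ffun c => f (phi (g' c))]; pose w' := [ffun a => w a].
have phiE : (phi' : _ -> _) = f \o (phi \o g').
  by apply/funext => c; rewrite /phi' ffunE.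
have qE : w' \o truncate l = f \o q.
  by rewrite wE; apply/funext => z; rewrite /= /w' ffunE.
apply: (t_ext (existT _ (cA, cC) (phi', existT _ l w'))).
rewrite /inextensible_code qE phiE; split=> //.
- exact: amalgamation_base_isomorphic isoA baseA.
- exact: epimorphism_comp epi_f (epimorphism_comp epi_phi epi_g').
- move=> [q' tq' phi_q']; apply: not_ext.
  exists (g' \o q') => [|z]; first exact: realizes_comp.
  exact/(can_inj fK)/phi_q'.
Qed.

Lemma gmeagre_not_rich : gmeagre x (~` rich).
Proof.
pose N (c : nat + extension_code) := match c with
  | inl l => ~` amalgamation_base_at l
  | inr c => inextensible_code c
  end.
apply: (@gmeagre_sub _ (\bigcup_c N c)) => [t not_rich|].
  apply: contrapT => tN; apply: not_rich.
  have {}tN c : ~ N c t by move=> Nct; apply: tN; exists c.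
  split=> [l|]; first by apply: contrapT; exact: (tN (inl l)).
  by apply: saturated_codes => c; exact: (tN (inr c)).
apply: gmeagre_bigcup => -[l|[cAC [phi [l f]]]].
  exact: gnowhere_dense_not_amalgamation_base_at.
exact: gnowhere_dense_inextensible.
Qed.

Variant base_pair t s : coloring_relation :=
  BasePair A (u v : Cantor -> A) of
    amalgamation_base A & realizes t u & realizes s v : base_pair t s u v.

Lemma base_pair_sym t s (E : finType) (u v : Cantor -> E) :
  base_pair t s u v -> base_pair s t v u.
Proof. by case=> A {}u {}v baseA tu sv; exact: BasePair. Qed.

Lemma base_pair_forth t s :
  (forall l, amalgamation_base_at l t) -> saturated s -> forth (base_pair t s).
Proof.
move=> t_base s_sat E u v l [A {}u {}v baseA tu sv].
have [[k uk] su] := realizes_coloring tu.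
have [C [p [baseC tp p_res]]] := t_base (maxn k l).
have /choice[sec secK] := (realizes_coloring tp).2.
have phi_p : (u \o sec) \o p =1 u.
  by move=> z; apply/uk/(agree_leq (leq_maxl k l))/p_res; exact: secK.
have [v' sv' phi_v'] :=
  s_sat _ _ _ _ baseA (realizes_epimorphism tu tp phi_p) sv.
exists C, p, v', (u \o sec); split=> //.
by move=> z y /p_res; apply: agree_leq; exact: leq_maxr.
Qed.

Lemma rich_conjugate t s :
  tuples t -> tuples s -> rich t -> rich s -> conj_orbit x t s.
Proof.
move=> tx sx [t_base t_sat] [s_base s_sat].
have point_pair := BasePair (@amalgamation_base_point n m)
  (realizes_point s) (realizes_point t).
have [| | |g [gx _ g_pair]] :=
    @back_and_forth n x (base_pair s t) _ _ _ _ _ _ point_pair.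
- move=> E u v [A {}u {}v _ su tv].
  split; [exact: realizes_coloring su|exact: realizes_coloring tv|move=> i /=].
  by rewrite (realizes_mark su) (realizes_mark tv).
- exact: base_pair_forth.
- move=> E u v l /base_pair_sym/(base_pair_forth t_base s_sat l).
  move=> [E' [u' [v' [f [uv' fu fv u_res]]]]].
  by exists E', u', v', f; split=> //; exact: base_pair_sym.
exists g; split=> // j y; apply: (can_inj (@hfunK g)); rewrite hinvK.
apply: agree_eq => l.
have [k tk] := locally_constant_comp_continuous (@hfun_cont (t j))
  (locally_constant_truncate l).
have [E [u [v [uv_base]]]] := g_pair (maxn k l).
case: uv_base => A {}u {}v _ su tv vg v_res.
have /(realizes_edge tv)[w wy ty] := realizes_edge_act (j, true) y su.
rewrite -vg in wy; rewrite -vg in ty.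
apply: agree_trans (_ : agree l (hfun (t j) w) _).
  by apply: agree_sym; apply: agree_leq (leq_maxr k l) _; exact: v_res.
by apply/truncate_eqP/tk; apply: agree_leq (leq_maxl k l) _; exact: v_res.
Qed.

End Realization.

Theorem theorem1p2 (n : nat) (x : 'I_n -> Cantor) (hx : injective x) :
  ample_generics x.
Proof.
move=> m; have meagre_not_rich := gmeagre_not_rich m hx.
have [t tx /contrapT rich_t] := gmeagre_complement_nonempty meagre_not_rich.
exists t; split=> //; apply: gmeagre_sub meagre_not_rich.
by move=> s [sx not_conj] rich_s; exact/not_conj/rich_conjugate.
Qed.
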